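(* Let $n = p_1^{k_1} \cdot p_2^{k_2} \cdots p_r^{k_r}$, where $r \geq 1$, $p_1, \dots, p_r$ are distinct primes and $k_1, \dots, k_r \geq 1$ are integers. Then $$P(\mathbb{Z}_n) = \prod_{i=1}^{r} \frac{(k_i+1)p_i - k_i}{p_i^{k_i+1}}.$$
   Context: $\mathbb{Z}_n$ denotes the ring of integers modulo $n$. For a finite ring $R$, $P(R)$ denotes the probability that two elements of $R$ chosen at random (with replacement) have product zero, i.e. $P(R) = \frac{|Ann|}{|R\times R|}$, where $Ann = \{(x,y) \in R\times R : xy = 0\}$. *)

(* Defs.v *)
From mathcomp Require Import all_boot all_order all_algebra.

Set Implicit Arguments.
Unset Strict Implicit.
Unset Printing Implicit Defensive.

Import GRing.Theory.
Local Open Scope ring_scope.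

Definition Ann (R : finPzRingType) : {set R * R} :=
  [set xy : R * R | xy.1 * xy.2 == 0].

(* The probability that the product of two uniformly random elements of R,
   drawn independently (with replacement), is zero. *)
Definition zero_product_prob (R : finPzRingType) : rat :=
  #|Ann R|%:R / #|[set: R * R]|%:R.

(* Main.v *)
(** For fixed [x] in [Z_n] there are exactly [gcd x n] solutions [y] of
    [x y = 0], so the number of annihilating pairs is Pillai's function
    [A n = \sum_(x < n) gcd x n].  It is multiplicative by the Chinese remainder
    theorem, and on prime powers it satisfies
    [A (p^(k+1)) = p A (p^k) + p^(k+1) - p^k], because passing from [p^k] to
    [p^(k+1)] changes the gcd with [x] only when [p^(k+1)] divides [x]. *)
Require Import Defs.
From mathcomp Require Import all_boot all_order all_algebra.
From mathcomp Require Import ring zify.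
Import GRing.Theory Num.Theory.

Local Open Scope ring_scope.

Definition pillai (n : nat) : nat := (\sum_(x < n) gcdn x n)%N.

Lemma sum_modn_periodic (m d : nat) (F : nat -> nat) :
  (\sum_(x < m * d) F (x %% d) = m * \sum_(x < d) F x)%N.
Proof.
rewrite -(big_mkord xpredT (fun x => F (x %% d)%N)) big_nat_mul big_mkord.
rewrite (eq_bigr (fun=> \sum_(x < d) F x)%N) => [|i _].
  by rewrite sum_nat_const card_ord.
rewrite -{1}[(i * d)%N]add0n big_addn mulSn addnK big_mkord.
by apply: eq_bigr => j _; rewrite addnC modnMDl modn_small.
Qed.

Lemma sum_eq0_ord (n c : nat) :
  (0 < n)%N -> (\sum_(x < n) (if x == 0 :> nat then c else 0) = c)%N.
Proof. by case: n => // n _; rewrite big_ord_recl /= big1 ?addn0. Qed.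

(** With [g = gcdn x n], [n] divides [x * y] iff [n / g] divides [y], and there are [g] multiples of
    [n / g] below [n = g * (n / g)]. *)
Lemma count_dvdn_mul (n x : nat) :
  (0 < n)%N -> (\sum_(y < n) (n %| x * y) = gcdn x n)%N.
Proof.
move=> n_gt0; have g_gt0 : (0 < gcdn x n)%N by rewrite gcdn_gt0 n_gt0 orbT.
pose m := (n %/ gcdn x n)%N.
have def_n : (n = gcdn x n * m)%N by rewrite mulnC divnK ?dvdn_gcdr.
have m_gt0 : (0 < m)%N by move: n_gt0; rewrite {1}def_n muln_gt0 => /andP[].
have dvdE y : (n %| x * y)%N = (y %% m == 0)%N.
  (* As [n] always divides [n * y], [x * y] may be replaced by
     [gcdn (x * y) (n * y) = gcdn x n * y], from which [gcdn x n] cancels. *)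
  have -> : (n %| x * y = (n %| gcdn (x * y) (n * y)))%N.
    by rewrite dvdn_gcd (dvdn_mulr y (dvdnn n)) andbT.
  by rewrite -muln_gcdl {1}def_n dvdn_pmul2l.
under eq_bigr => y _ do rewrite dvdE.
set g := gcdn x n in def_n *; rewrite def_n.
rewrite (sum_modn_periodic _ _ (fun y => if y == 0%N then 1 else 0)%N).
by rewrite sum_eq0_ord ?muln1.
Qed.

Lemma card_Ann_Zn (n : nat) : (1 < n)%N -> #|Ann 'Z_n| = pillai n.
Proof.
case: n => [|[|n]] // _; rewrite -sum1dep_card /pillai.
rewrite -(pair_big_dep xpredT (fun x y : 'Z_n.+2 => x * y == 0)
  (fun _ _ => 1%N)) /=.
apply: eq_bigr => x _; rewrite -count_dvdn_mul // big_mkcond /=.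
by apply: eq_bigr => y _; rewrite -val_eqE /= /dvdn; case: ifP.
Qed.

Lemma gcdnMr_coprime (x m n : nat) :
  coprime m n -> gcdn x (m * n) = (gcdn x m * gcdn x n)%N.
Proof.
move=> co_mn; apply/eqP; rewrite eqn_dvd; apply/andP; split.
  rewrite muln_gcdl !muln_gcdr !dvdn_gcd dvdn_gcdr.
  by rewrite (dvdn_mulr x) ?(dvdn_mulr n) ?(dvdn_mull m) ?dvdn_gcdl.
rewrite Gauss_dvd.
  by rewrite !dvdn_gcd !dvdn_gcdl (dvdn_mulr _ (dvdn_gcdr x m))
    (dvdn_mull _ (dvdn_gcdr x n)).
exact: coprime_dvdl (dvdn_gcdr x m) (coprime_dvdr (dvdn_gcdr x n) co_mn).
Qed.

(** Chinese remaindering reindexes the sum by pairs of residues; the gcds with [m] and [n] depend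
    only on these residues, and their product is the gcd with [m * n]. *)
Lemma pillaiM (m n : nat) :
  (0 < m)%N -> (0 < n)%N -> coprime m n ->
  pillai (m * n) = (pillai m * pillai n)%N.
Proof.
case: m n => [|m] [|n] // _ _ co_mn.
pose h (x : 'I_(m.+1 * n.+1)) : 'I_m.+1 * 'I_n.+1 :=
  (inord (x %% m.+1), inord (x %% n.+1)).
have h_inj : injective h.
  move=> x y /(congr1 (fun z => (val z.1, val z.2))) /=.
  rewrite !inordK ?ltn_pmod // => -[xy_m xy_n]; apply: val_inj => /=.
  rewrite -(modn_small (ltn_ord x)) -(modn_small (ltn_ord y)).
  by apply/eqP; rewrite chinese_remainder // xy_m xy_n !eqxx.
have h_bij : bijective h by apply: inj_card_bij; rewrite // card_prod !card_ord.
rewrite /pillai big_distrlr /= pair_big /= (reindex h) /=; last exact: onW_bij.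
apply: eq_bigr => x _; rewrite !inordK ?ltn_pmod // !gcdn_modl.
exact: gcdnMr_coprime.
Qed.

(** The gcd on the left is some [p ^ j]. Unless [p ^ k.+1] divides [x], [j <= k], so it already
    divides [p ^ k]. *)
Lemma gcdn_prime_expS (p k x : nat) : prime p ->
  gcdn x (p ^ k.+1) =
  (gcdn x (p ^ k) + if x %% p ^ k.+1 == 0 then p ^ k.+1 - p ^ k else 0)%N.
Proof.
move=> p_pr; have p_gt0 := prime_gt0 p_pr.
have le_pk : (p ^ k <= p ^ k.+1)%N by rewrite leq_pexp2l.
have dvd_pk : (p ^ k %| p ^ k.+1)%N by rewrite dvdn_exp2l.
case: ifP => [dvd_x | ndvd_x].
  by rewrite !(gcdn_idPr _) ?subnKC // (dvdn_trans dvd_pk).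
rewrite addn0; apply/eqP; rewrite eqn_dvd !dvdn_gcd !dvdn_gcdl /=.
rewrite (dvdn_trans (dvdn_gcdr _ _) dvd_pk) andbT.
have /(dvdn_pfactor _ _ p_pr)[j le_j def_g] := dvdn_gcdr x (p ^ k.+1).
rewrite def_g dvdn_exp2l // -ltnS ltn_neqAle le_j andbT.
apply: contraFneq ndvd_x => eq_j.
by rewrite -/(p ^ k.+1 %| x)%N -eq_j -def_g dvdn_gcdl.
Qed.

(** This is [A (p^k) = (k+1) p^k - k p^(k-1)], multiplied by [p] and rearranged to avoid truncated
    subtraction and the exponent [k-1]. *)
Lemma pillai_prime_exp (p k : nat) : prime p ->
  (p * pillai (p ^ k) + k * p ^ k = k.+1 * p ^ k.+1)%N.
Proof.
move=> p_pr; have p_gt0 := prime_gt0 p_pr.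
elim: k => [|k IHk].
  by rewrite /pillai expn0 big_ord1 gcdn1 mul0n addn0 mul1n muln1.
have -> : pillai (p ^ k.+1) = (p * pillai (p ^ k) + (p ^ k.+1 - p ^ k))%N.
  rewrite {1}/pillai; under eq_bigr => x _ do rewrite gcdn_prime_expS //.
  rewrite big_split /=; congr addn.
    under eq_bigr => x _ do rewrite -gcdn_modl.
    by rewrite expnS (sum_modn_periodic _ _ (fun x => gcdn x (p ^ k))).
  under eq_bigr => x _ do rewrite modn_small //.
  by rewrite sum_eq0_ord ?expn_gt0 ?p_gt0.
have le_pk : (p ^ k <= p ^ k.+1)%N by rewrite leq_pexp2l.
(* The difference becomes a variable [d] with [d + p ^ k = p ^ k.+1], leaving [nia] a
   subtraction-free goal. *)
have := subnK le_pk; move: (p ^ k.+1 - p ^ k)%N => d.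
move: IHk; rewrite !expnS; nia.
Qed.

(** Induction peels one index off [s]; [uniq s] and injectivity of [p] make its prime differ from
    those of the tail, which gives coprimality. *)
Lemma pillai_prod (r : nat) (s : seq 'I_r) (p k : 'I_r -> nat) :
  (forall i, prime (p i)) -> injective p -> uniq s ->
  pillai (\prod_(i <- s) p i ^ k i) = (\prod_(i <- s) pillai (p i ^ k i))%N.
Proof.
move=> p_pr p_inj; elim: s => [|i s IHs] /=.
  by rewrite !big_nil /pillai big_ord1 gcdn1.
case/andP=> i_s s_uniq; rewrite !big_cons -IHs //.
apply: pillaiM; first by rewrite expn_gt0 prime_gt0.
  by apply: prodn_gt0 => j; rewrite expn_gt0 prime_gt0.
rewrite big_seq; elim/big_ind: _ => [|a b co_a co_b|j j_s].
- exact: coprimen1.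
- by rewrite coprimeMr co_a.
apply: coprimeXl; apply: coprimeXr.
rewrite prime_coprime // dvdn_prime2 //; apply: contra i_s => /eqP/p_inj -> //.
Qed.

Theorem corollary3p2 (r n : nat) (p k : 'I_r -> nat)
    (r_ge1 : (1 <= r)%N)
    (p_prime : forall i : 'I_r, prime (p i))
    (p_distinct : injective p)
    (k_ge1 : forall i : 'I_r, (1 <= k i)%N)
    (n_fact : n = (\prod_(i < r) p i ^ k i)%N) :
  zero_product_prob 'Z_n =
    \prod_(i < r)
      ((((k i)%:R + 1) * (p i)%:R - (k i)%:R) / (p i)%:R ^+ (k i + 1)).
Proof.
have pX_gt0 i : (0 < p i ^ k i)%N by rewrite expn_gt0 prime_gt0.
(* ['Z_n] has [n] elements only for [n > 1]: both ['Z_0] and ['Z_1] are ['I_2]. *)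
have n_gt1 : (1 < n)%N.
  rewrite n_fact; case: r r_ge1 p k p_prime k_ge1 pX_gt0 {p_distinct n_fact}
    => // r' _ p k p_pr k_gt0 pX_gt0.
  rewrite big_ord_recl; apply: (@leq_trans (p ord0 ^ k ord0 * 1)).
    by rewrite muln1 -(exp1n (k ord0)) ltn_exp2r ?prime_gt1.
  by rewrite leq_mul2l prodn_gt0 ?orbT.
rewrite /zero_product_prob card_Ann_Zn // cardsT card_prod.
have -> : #|'Z_n| = n by rewrite card_ord Zp_cast.
rewrite {}n_fact pillai_prod ?index_enum_uniq // natrM !natr_prod.
rewrite -big_split -prodf_div /=; apply: eq_bigr => i _.
have p_neq0 : (p i)%:R != 0 :> rat by rewrite pnatr_eq0 -lt0n prime_gt0.
have /(congr1 (fun m => m%:R : rat)) := pillai_prime_exp (p i) (k i) (p_prime i).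
rewrite natrD !natrM !natrX -!natr1 exprS addn1 exprS.
set P := (p i)%:R in p_neq0 *; set q := P ^+ k i; set K := (k i)%:R => def_A.
have q_neq0 : q != 0 by rewrite expf_neq0.
(* The factor [P] makes [P * pillai (p i ^ k i)] appear, the quantity that [def_A] determines. *)
apply: (mulfI p_neq0); rewrite mulrA.
have -> : P * (pillai (p i ^ k i))%:R = (K + 1) * (P * q) - K * q.
  by rewrite -def_A addrK.
by field; rewrite p_neq0 q_neq0.
Qed.
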